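(* Let $p \in [1,\infty]$ with $p \neq 2$ and let $n\geq 2$ be an integer. Then the $p$-cone $\mathcal{L}_p^{n+1}$ is not self-dual under any inner product on $\mathbb{R}^{n+1}$; that is, for every inner product $\langle\cdot,\cdot\rangle$ on $\mathbb{R}^{n+1}$, the dual cone of $\mathcal{L}_p^{n+1}$ with respect to $\langle\cdot,\cdot\rangle$ is different from $\mathcal{L}_p^{n+1}$.
   Context: For $p\in[1,\infty]$ the $p$-cone is $\mathcal{L}_p^{n+1} = \{(t,x)\in\mathbb{R}\times\mathbb{R}^n \mid t\geq \|x\|_p\}\subseteq\mathbb{R}^{n+1}$, where $\|x\|_p=(|x_1|^p+\cdots+|x_n|^p)^{1/p}$ for $p\in[1,\infty)$ and $\|x\|_\infty=\max(|x_1|,\ldots,|x_n|)$. The dual cone of a convex cone $\mathcal{K}\subseteq\mathbb{R}^m$ with respect to an inner product $\langle\cdot,\cdot\rangle$ on $\mathbb{R}^m$ is $\{x\in\mathbb{R}^m\mid \langle x,y\rangle\geq 0\ \ \forall y\in\mathcal{K}\}$. *)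

(* Defs.v *)
From mathcomp Require Import all_boot all_order all_algebra.
From mathcomp Require Import all_classical all_reals all_analysis.

Set Implicit Arguments.
Unset Strict Implicit.
Unset Printing Implicit Defensive.

Import Order.TTheory GRing.Theory Num.Theory.

Local Open Scope classical_set_scope.
Local Open Scope ring_scope.

(* The exponent ranges over [\bar R] so that [p = +oo] is allowed; the value
   at [-oo], and at exponents below 1, is junk. *)
Definition pnorm (R : realType) (p : \bar R) (n : nat) (x : 'rV[R]_n) : R :=
  match p with
  | EFin r => (\sum_(i < n) `|x 0 i| `^ r) `^ r^-1
  | +oo%E => \big[Num.max/0]_(i < n) `|x 0 i|
  | -oo%E => 0
  end.

(* A point (t, x) of R x R^n is the row vector [row_mx t%:M x]. *)
Definition pcone (R : realType) (p : \bar R) (n : nat) : set 'rV[R]_(1 + n) :=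
  [set v | pnorm p (rsubmx v) <= lsubmx v 0 0].

Arguments pcone {R} p n _.

Definition dual_cone (R : realType) (V : lmodType R)
    (ip : {dot V for @idfun R}) (K : set V) : set V :=
  [set x | forall y, K y -> 0 <= ip x y].

Definition self_dual (R : realType) (V : lmodType R)
    (ip : {dot V for @idfun R}) (K : set V) : Prop :=
  dual_cone ip K = K.

(* Main.v *)
Require Import Defs.
From mathcomp Require Import all_boot all_order all_algebra.
From mathcomp Require Import all_classical all_reals all_analysis.
From mathcomp Require Import ring lra.

Import Order.TTheory GRing.Theory Num.Theory.

Local Open Scope ring_scope.

(* Let K be the p-cone, e_0 the time axis and e_1, ..., e_n the space axes, and
   suppose that K is self-dual for <.,.>. Let g and h_i represent the coordinate
   forms t and x_i through <.,.>. Every linear form that is nonnegative on K is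
   then represented by a vector of K; for instance u = g - h_1 lies in K and is
   orthogonal to the boundary point e_0 + e_1.

   - 2 < p < oo: the boundary of K is flat to order p > 2 at e_0 + e_1 in the
     direction e_2, so by duality it is sharply curved at u; but the p-norm is
     2-uniformly smooth.
   - 1 < p < 2: by Hoelder, (1 + s^q) g - h_1 - s h_2 lies in K for the
     conjugate exponent q > 2, so the boundary of K is flat to order q at u;
     but the p-norm is 2-uniformly convex.
   - p = 1 or p = oo: extremal vectors of K represent facets of K, which yields
     equations between the inner products of e_0, e_i, e_j (p = 1) or of
     g, h_i, h_j (p = oo) that contradict the strict Cauchy-Schwarz
     inequality. *)

(** * Scalar inequalities for real powers *)

Section PowerInequalities.
Context {R : realType}.
Implicit Types (a b p q t x y M : R).

(** Young's inequality for [y] and [1] with conjugate exponents [p] and [p / (p - 1)], multiplied by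
    [p]. *)
Lemma powR_bernoulli p y : 1 <= p -> 0 <= y -> 1 + p * (y - 1) <= y `^ p.
Proof.
move=> p1 y0; have [->|pn1] := eqVneq p 1; first by rewrite powRr1 //; lra.
have pgt1 : 1 < p by rewrite lt_neqAle eq_sym pn1.
have pp : 0 < p by lra.
have ppn : p != 0 by lra.
have p1n : p - 1 != 0 by lra.
have q0 : 0 < p / (p - 1) by rewrite divr_gt0 //; lra.
have := @conjugate_powR _ y 1 p (p / (p - 1)) y0 ler01 pp q0.
rewrite powR1 mulr1 => /(_ _)/wrap[]; first by field; apply/andP.
rewrite -(ler_pM2l pp) => h.
suff : p * (y `^ p / p + 1 / (p / (p - 1))) = y `^ p + (p - 1) by lra.
by field; apply/andP.
Qed.

Lemma powR_bernoulli_le t y : 0 < t <= 1 -> 0 <= y -> y `^ t <= 1 + t * (y - 1).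
Proof.
move=> /andP[t0 t1] y0.
have := @powR_bernoulli t^-1 (y `^ t).
rewrite -powRrM divff ?gt_eqF // powRr1 // invf_ge1 //.
move=> /(_ t1 (powR_ge0 _ _)).
rewrite -(ler_pM2l t0) mulrDr mulrA divff ?gt_eqF //; lra.
Qed.

(** For [x >= 0], the left side minus 2 is the square of [expR (x / 2) - expR (- (x / 2))], and this
    difference is [expR (x / 2) * (1 - expR (- x)) <= x * expR (x / 2)]. *)
Lemma expR_symm_le x : expR x + expR (- x) <= 2 + x ^+ 2 * expR `|x|.
Proof.
wlog x0 : x / 0 <= x.
  move=> H; have [/H//|/ltW x0] := leP 0 x.
  by have := H (- x); rewrite opprK normrN sqrrN oppr_ge0 => /(_ x0); lra.
rewrite ger0_norm //.
have Ex : expR x = expR (x / 2) ^+ 2 by rewrite -expRM_natr; congr expR; lra.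
have Ey : expR (- x) = expR (- (x / 2)) ^+ 2.
  by rewrite -expRM_natr; congr expR; lra.
have E1 : expR (x / 2) * expR (- (x / 2)) = 1 by rewrite -expRD subrr expR0.
have E2 : expR (x / 2) * expR (- x) = expR (- (x / 2)).
  by rewrite -expRD; congr expR; lra.
have l1 := expR_ge1Dx (- x).
have u0 := expR_gt0 (x / 2).
have v0 : expR (- (x / 2)) <= expR (x / 2) by rewrite ler_expR; lra.
have h : expR (x / 2) - expR (- (x / 2)) <= x * expR (x / 2).
  by rewrite -E2; nra.
have : (expR (x / 2) - expR (- (x / 2))) ^+ 2 <= (x * expR (x / 2)) ^+ 2.
  by rewrite lerXn2r // nnegrE; nra.
rewrite Ex Ey; nra.
Qed.

Lemma normDM a b : a != 0 -> `|b| <= `|a| -> `|a + b| = `|a| * (1 + b / a).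
Proof.
move=> a0 ba; have -> : a + b = a * (1 + b / a) by field.
rewrite normrM [X in _ * X]ger0_norm //.
have : `|b / a| <= 1 by rewrite normrM normfV ler_pdivrMr ?normr_gt0 // mul1r.
by rewrite ler_norml => /andP[]; lra.
Qed.

Lemma powR_norm_split p a b : a != 0 -> `|b| <= `|a| ->
  [/\ `|b / a| <= 1,
    `|a + b| `^ p = `|a| `^ p * (1 + b / a) `^ p &
    `|a - b| `^ p = `|a| `^ p * (1 - b / a) `^ p].
Proof.
move=> a0 ba.
have e1 : `|b / a| <= 1.
  by rewrite normrM normfV ler_pdivrMr ?normr_gt0 // mul1r.
have /andP[l u] : - 1 <= b / a <= 1 by rewrite -ler_norml.
split => //.
  by rewrite normDM // powRM //; lra.
rewrite normDM ?normrN // mulNr powRM //; lra.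
Qed.

(** Coordinatewise 2-uniform smoothness on bounded sets. If [|b| <= |a|], put [e = b / a] and bound
    the powers of [1 + e] and [1 - e] by exponentials, whose linear terms cancel in the sum.
    Otherwise both powers are at most a multiple of [|b|^p <= M^(p - 2) * b^2]. *)
Lemma powR_two_smooth p M : 2 <= p -> exists2 C, 0 <= C &
  forall a b, `|a| <= M -> `|b| <= M ->
  `|a + b| `^ p + `|a - b| `^ p <= 2 * `|a| `^ p + C * b ^+ 2.
Proof.
move=> p2.
have split_pow y : 0 <= y -> y `^ p = y `^ (p - 2) * y ^+ 2.
  move=> y0; have [->|yn0] := eqVneq y 0.
    by rewrite powR0 ?expr0n /= ?mulr0 //; lra.
  by rewrite -powR_mulrn // -powRD ?subrK // yn0 implybT.
pose D := M `^ (p - 2).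
have D0 : 0 <= D by apply: powR_ge0.
have K0 : 0 <= expR p * p ^+ 2 * D.
  by rewrite mulr_ge0 // mulr_ge0 ?expR_ge0 ?sqr_ge0.
have L0 : 0 <= 2 * 2 `^ p * D by rewrite mulr_ge0 // mulr_ge0 // powR_ge0.
exists (expR p * p ^+ 2 * D + 2 * 2 `^ p * D); first exact: addr_ge0.
move=> a b aM bM.
have leD y : `|y| <= M -> `|y| `^ (p - 2) <= D.
  move=> yM; apply: ge0_ler_powR => //; rewrite ?nnegrE //; first lra.
  exact: le_trans yM.
have [-> |a0] := eqVneq a 0.
  rewrite add0r sub0r normrN normr0 powR0; last lra.
  rewrite split_pow // real_normK ?num_real //.
  have := ler_wpM2r (sqr_ge0 b) (leD _ bM).
  have h1 : 1 <= 2 `^ p by rewrite -[leLHS](powRr0 2); apply: ler_powR; lra.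
  have : 0 <= D * b ^+ 2 by rewrite mulr_ge0 // sqr_ge0.
  have := mulr_ge0 K0 (sqr_ge0 b).
  by nra.
have [ba|/ltW ab] := leP `|b| `|a|.
  have [e1 -> ->] := powR_norm_split p _ _ a0 ba.
  set e := b / a in e1 *.
  have pos : 0 <= p by lra.
  have := e1; rewrite ler_norml => /andP[l u].
  have h z : 0 <= 1 + z -> (1 + z) `^ p <= expR (p * z).
    move=> z0; rewrite mulrC expRM.
    by apply: ge0_ler_powR; rewrite ?nnegrE ?expR_ge0 // expR_ge1Dx.
  have h1 : (1 + e) `^ p <= expR (p * e) by apply: h; lra.
  have h2 : (1 - e) `^ p <= expR (- (p * e)).
    by rewrite -[- (p * e)]mulrN; apply: h; lra.
  have h3 := expR_symm_le (p * e).
  have h4 : expR `|p * e| <= expR p.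
    by rewrite ler_expR normrM ger0_norm // ler_piMr.
  have h5 : (p * e) ^+ 2 * expR `|p * e| <= (p * e) ^+ 2 * expR p.
    by rewrite ler_wpM2l // sqr_ge0.
  have h6 : (1 + e) `^ p + (1 - e) `^ p <= 2 + p ^+ 2 * expR p * e ^+ 2.
    by rewrite exprMn in h3 h5; lra.
  have h7 : `|a| `^ p * e ^+ 2 <= D * b ^+ 2.
    rewrite split_pow // real_normK ?num_real //.
    have -> : `|a| `^ (p - 2) * a ^+ 2 * e ^+ 2 = `|a| `^ (p - 2) * b ^+ 2.
      by rewrite /e; field.
    by rewrite ler_wpM2r ?sqr_ge0 // leD.
  have h8 := mulr_ge0 L0 (sqr_ge0 b).
  have h9 := ler_wpM2l (powR_ge0 `|a| p) h6.
  have h10 := ler_wpM2l (mulr_ge0 (sqr_ge0 p) (expR_ge0 p)) h7.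
  by lra.
have hb z : `|z| <= 2 * `|b| -> `|z| `^ p <= 2 `^ p * D * b ^+ 2.
  move=> zb.
  have : `|z| `^ p <= (2 * `|b|) `^ p.
    by apply: ge0_ler_powR; rewrite ?nnegrE //; lra.
  rewrite powRM // [`|b| `^ p]split_pow // real_normK ?num_real // => h.
  apply: (le_trans h); rewrite -mulrA ler_wpM2l ?powR_ge0 //.
  by rewrite ler_wpM2r ?sqr_ge0 // leD.
have h1 : `|a + b| `^ p <= 2 `^ p * D * b ^+ 2.
  by apply: hb; have := ler_normD a b; lra.
have h2 : `|a - b| `^ p <= 2 `^ p * D * b ^+ 2.
  by apply: hb; have := ler_normB a b; lra.
have h3 := mulr_ge0 K0 (sqr_ge0 b).
have := powR_ge0 `|a| p; lra.
Qed.

(** Write [y^2 = y^p * y^(2 - p)] and bound the concave factor [y^(2 - p)] by its tangent at 1. This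
    bounds both powers below by rational functions of [x]. *)
Lemma powR_two_convex1 p x : 1 < p < 2 -> `|x| <= 1 ->
  2 + 2 * (p - 1) ^+ 2 * x ^+ 2 <= (1 + x) `^ p + (1 - x) `^ p.
Proof.
move=> /andP[p1 p2]; rewrite ler_norml => /andP[l u].
have core y : 0 <= y -> y ^+ 2 <= y `^ p * (1 + (2 - p) * (y - 1)).
  move=> y0; have -> : y ^+ 2 = y `^ p * y `^ (2 - p).
    rewrite -powRD; last by rewrite addrC subrK pnatr_eq0.
    by rewrite addrC subrK powR_mulrn.
  by rewrite ler_wpM2l ?powR_ge0 // powR_bernoulli_le //; lra.
have hA : (1 + x) ^+ 2 <= (1 + x) `^ p * (1 + (2 - p) * (1 + x - 1)).
  by apply: core; lra.
have hB : (1 - x) ^+ 2 <= (1 - x) `^ p * (1 + (2 - p) * (1 - x - 1)).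
  by apply: core; lra.
set A := _ `^ p in hA *; set B := _ `^ p in hB *.
set t := 2 - p in hA hB *; have -> : p - 1 = 1 - t by rewrite /t; lra.
have t0 : 0 < t < 1 by rewrite /t; lra.
have a1 : 0 < 1 + t * x by nra.
have a2 : 0 < 1 - t * x by nra.
have x2 : 0 <= x ^+ 2 by apply: sqr_ge0.
have w1 : (1 + x) ^+ 2 * (1 - t * x) <= A * (1 + t * x) * (1 - t * x).
  by rewrite ler_pM2r //; lra.
have w2 : (1 - x) ^+ 2 * (1 + t * x) <= B * (1 - t * x) * (1 + t * x).
  by rewrite ler_pM2r //; lra.
have w3 : 0 < (1 + t * x) * (1 - t * x) by rewrite mulr_gt0.
rewrite -(ler_pM2r w3).
(* With denominators cleared, the rational lower bound exceeds the left side by exactly twice this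
   term. *)
have : 0 <= (1 - t) ^+ 2 * x ^+ 2 * (t * x) ^+ 2.
  by rewrite mulr_ge0 ?sqr_ge0 // mulr_ge0 ?sqr_ge0.
by lra.
Qed.

Lemma powR_two_convex p M : 1 < p < 2 -> 0 < M -> exists2 c, 0 < c &
  forall a b, `|a| <= M -> `|b| <= M ->
  2 * `|a| `^ p + c * b ^+ 2 <= `|a + b| `^ p + `|a - b| `^ p.
Proof.
move=> pb M0; have /andP[p1 p2] := pb.
pose k := (p - 1) ^+ 2.
have k0 : 0 < k by rewrite exprn_gt0 //; lra.
have k1 : k <= 1 by rewrite /k expr_le1 //; lra.
have D0 : 0 < M `^ (2 - p) by apply: powR_gt0.
set D := _ `^ _ in D0.
exists (k / D); first exact: divr_gt0.
move=> a b aM bM.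
have sqle y : `|y| <= M -> y ^+ 2 / D <= `|y| `^ p.
  move=> yM; rewrite ler_pdivrMr //.
  have -> : y ^+ 2 = `|y| `^ p * `|y| `^ (2 - p).
    rewrite -powRD; last by rewrite addrC subrK pnatr_eq0.
    by rewrite addrC subrK powR_mulrn // real_normK // num_real.
  rewrite ler_wpM2l ?powR_ge0 //.
  by apply: ge0_ler_powR; rewrite ?nnegrE //; lra.
have [/andP[/eqP-> /eqP->]|] := boolP ((a == 0) && (b == 0)).
  by rewrite expr0n /= mulr0 !addr0 subr0 normr0 powR0 //; lra.
rewrite negb_and => ab0.
have [ba|ab] := leP `|b| `|a|.
  have a0 : a != 0.
    case/orP: ab0 => // b0; rewrite -normr_gt0.
    by apply: lt_le_trans ba; rewrite normr_gt0.
  have [e1 -> ->] := powR_norm_split p _ _ a0 ba.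
  have h := powR_two_convex1 _ _ pb e1.
  have := ler_wpM2l (powR_ge0 `|a| p) h; rewrite -/k.
  have := ler_wpM2r (sqr_ge0 (b / a)) (sqle _ aM).
  have -> : a ^+ 2 / D * (b / a) ^+ 2 = b ^+ 2 / D.
    by field; rewrite a0 andbT gt_eqF.
  set w := `|a| `^ p * (b / a) ^+ 2 => w1 w2.
  have w3 : k * (b ^+ 2 / D) <= k * w by rewrite ler_pM2l.
  have w4 : 0 <= k * w.
    by rewrite mulr_ge0 ?(ltW k0) // /w mulr_ge0 ?powR_ge0 // sqr_ge0.
  have -> : k / D * b ^+ 2 = k * (b ^+ 2 / D) by ring.
  by rewrite /w in w1 w2 w3 w4 *; lra.
have b0 : b != 0.
  by rewrite -normr_gt0; apply: le_lt_trans ab.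
have [e1] := powR_norm_split p _ _ b0 (ltW ab).
rewrite addrC -[`|b - a|]normrN opprB => -> ->.
have h := powR_two_convex1 _ _ pb e1.
rewrite -mulrDr.
have E : `|a| `^ p = `|b| `^ p * `|a / b| `^ p.
  by rewrite -powRM // -normrM; congr (`|_| `^ _); field.
have y1 : `|a / b| `^ p <= `|a / b|.
  have [->|z0] := eqVneq (a / b) 0; first by rewrite normr0 powR0 //; lra.
  by apply: ge1r_powR; rewrite ?normr_gt0 ?z0 //; lra.
have bb := sqle _ bM.
have -> : k / D * b ^+ 2 = k * (b ^+ 2 / D) by ring.
have w1 : k * (b ^+ 2 / D) <= k * `|b| `^ p by rewrite ler_pM2l.
suff : `|b| `^ p * (2 * `|a / b| `^ p + k) <=
  `|b| `^ p * ((1 + a / b) `^ p + (1 - a / b) `^ p) by rewrite E; lra.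
rewrite ler_wpM2l ?powR_ge0 //.
apply: le_trans h; rewrite -/k -[(a / b) ^+ 2]real_normK ?num_real //.
(* It remains to see [2 * y + k <= 2 + 2 * k * y^2]. Since [k <= 1],
   [2 * (1 - y) >= 2 * k * (1 - y)], and what is left is a square plus a positive constant, times
   [k]. *)
set y := `|a / b| in e1 y1 *.
have y0 : 0 <= y by apply: normr_ge0.
have f1 : 0 <= (1 - k) * (1 - y) by rewrite mulr_ge0 //; lra.
have f2 : 0 <= k * (y - 1 / 2) ^+ 2 by rewrite mulr_ge0 ?sqr_ge0 // ltW.
have f3 : 0 <= k * y ^+ 2 by rewrite mulr_ge0 ?sqr_ge0 // ltW.
by lra.
Qed.

Lemma powR_small (e C l t : R) : 0 < e -> 0 <= C -> 0 < l ->
  0 < t -> exists2 s, 0 < s <= t & C * s `^ e < l.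
Proof.
move=> e0 C0 l0 t0; pose y := l / (l + C).
have y0 : 0 < y by rewrite divr_gt0 //; lra.
have yC : C * y < l.
  by rewrite /y mulrA ltr_pdivrMr; [nra|lra].
exists (Num.min (y `^ e^-1) t).
  by rewrite lt_min powR_gt0 // t0 ge_min lexx orbT.
apply: le_lt_trans yC; rewrite ler_wpM2l //.
rewrite -[leRHS]powRr1 ?(ltW y0) // -(mulVf (lt0r_neq0 e0)) powRrM.
apply: ge0_ler_powR; rewrite ?nnegrE ?powR_ge0 ?(ltW e0) //.
  by rewrite le_min powR_ge0 ltW.
by rewrite ge_min lexx.
Qed.

End PowerInequalities.

(** * Inner products, self-duality and representing vectors *)

Section DotProduct.
Context {R : realType} {V : lmodType R} (ip : {dot V for @idfun R}).
Implicit Types (u v w : V) (a : R).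

Lemma dotC u v : ip u v = ip v u.
Proof. by rewrite hermC /= expr0 mul1r. Qed.

Lemma dotDl u v w : ip (u + v) w = ip u w + ip v w.
Proof. exact: linearDl. Qed.

Lemma dotDr u v w : ip u (v + w) = ip u v + ip u w.
Proof. exact: linearDr. Qed.

Lemma dotNl u v : ip (- u) v = - ip u v.
Proof. exact: linearNl. Qed.

Lemma dotNr u v : ip u (- v) = - ip u v.
Proof. exact: linearNr. Qed.

Lemma dotZl a u v : ip (a *: u) v = a * ip u v.
Proof. exact: linearZl_LR. Qed.

Lemma dotZr a u v : ip u (a *: v) = a * ip u v.
Proof. exact: linearZr_LR. Qed.

Lemma dot_suml I (r : seq I) (F : I -> V) v :
  ip (\sum_(i <- r) F i) v = \sum_(i <- r) ip (F i) v.
Proof. exact: linear_sumlz. Qed.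

Lemma dot_sumr I (r : seq I) (F : I -> V) v :
  ip v (\sum_(i <- r) F i) = \sum_(i <- r) ip v (F i).
Proof. exact: linear_sumr. Qed.

Definition dotE := (dotDl, dotDr, dotNl, dotNr, dotZl, dotZr).

Lemma dot_gt0 u : u != 0 -> 0 < ip u u.
Proof. exact: neq0_dnorm_gt0. Qed.

Lemma dot_neq0 u v : ip u v != 0 -> v != 0.
Proof. by apply: contra_neq => ->; exact: linear0r. Qed.

Lemma self_dualP {K : set V} : self_dual ip K ->
  forall v, K v <-> (forall y, K y -> 0 <= ip v y).
Proof. by move=> sd v; rewrite -{1}sd. Qed.

(** Adding the two equations gives [max(|<u,w>|, |<v,w>|) = <u,u>]. Both [<v,v>] and [<w,w>] are at
    most [<u,u>], and the four nonzero vectors make [|<u,w>|] and [|<v,w>|] strictly smaller than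
    the mean of the squared norms involved. *)
Lemma dot_absurd u v w :
  u + w != 0 -> u - w != 0 -> v + w != 0 -> v - w != 0 ->
  0 <= ip (u + v) (u - v) -> 0 <= ip (u + w) (u - w) ->
  `|ip (u + v) w| = ip (u + v) u -> `|ip (u - v) w| = ip (u - v) u -> False.
Proof.
move=> /dot_gt0 + /dot_gt0 + /dot_gt0 + /dot_gt0.
rewrite !dotE (dotC w u) (dotC v u) (dotC w v).
by case: (ger0P (ip u w + ip v w)); case: (ger0P (ip u w - ip v w)); lra.
Qed.

End DotProduct.

(** Riesz representation of the coordinate forms: the Gram matrix [S] is invertible by positive
    definiteness, and the rows of its inverse are the representing vectors. *)
Lemma dot_coord {R : realType} {m : nat} (ip : {dot 'rV[R]_m for @idfun R}) :
  exists h : 'I_m -> 'rV[R]_m, forall k v, ip (h k) v = v 0 k.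
Proof.
pose S := \matrix_(i, j) ip (delta_mx 0 i) (delta_mx 0 j).
have ipE u v : ip u v = (u *m S *m v^T) 0 0.
  rewrite {1}[u]row_sum_delta {1}[v]row_sum_delta dot_sumr mxE.
  apply: eq_bigr => j _; rewrite dotZr dot_suml !mxE mulr_sumr mulr_suml.
  by apply: eq_bigr => i _; rewrite dotZl !mxE; ring.
have Su : S \in unitmx.
  rewrite -row_free_unit; apply: inj_row_free => v vS.
  apply/eqP/negP => /negP/(dot_gt0 ip).
  by rewrite ipE vS mul0mx mxE ltxx.
exists (fun k => delta_mx 0 k *m invmx S) => k v.
by rewrite ipE mulmxKV // -rowE !mxE.
Qed.

(** * Time and space coordinates; membership in the cone *)

Section Cone.
Context {R : realType} {n : nat}.
Implicit Types (v w : 'rV[R]_(1 + n)) (p : R).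

Definition time v : R := v 0 (lshift n 0).
Definition space v (i : 'I_n) : R := v 0 (rshift 1 i).
Definition time_vec : 'rV[R]_(1 + n) := delta_mx 0 (lshift n 0).
Definition space_vec (i : 'I_n) : 'rV[R]_(1 + n) := delta_mx 0 (rshift 1 i).

Lemma timeD v w : time (v + w) = time v + time w.
Proof. by rewrite /time mxE. Qed.

Lemma timeN v : time (- v) = - time v.
Proof. by rewrite /time mxE. Qed.

Lemma timeZ (a : R) v : time (a *: v) = a * time v.
Proof. by rewrite /time mxE. Qed.

Lemma spaceD v w i : space (v + w) i = space v i + space w i.
Proof. by rewrite /space mxE. Qed.

Lemma spaceN v i : space (- v) i = - space v i.
Proof. by rewrite /space mxE. Qed.

Lemma spaceZ (a : R) v i : space (a *: v) i = a * space v i.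
Proof. by rewrite /space mxE. Qed.

Lemma time_time_vec : time time_vec = 1.
Proof. by rewrite /time mxE !eqxx. Qed.

Lemma time_space_vec i : time (space_vec i) = 0.
Proof. by rewrite /time mxE eq_lrshift andbF. Qed.

Lemma space_time_vec i : space time_vec i = 0.
Proof. by rewrite /space mxE eq_rlshift andbF. Qed.

Lemma space_space_vec i j : space (space_vec i) j = (j == i)%:R.
Proof. by rewrite /space mxE eq_rshift. Qed.

Definition coordE := (timeD, timeN, timeZ, spaceD, spaceN, spaceZ,
  time_time_vec, time_space_vec, space_time_vec, space_space_vec).

Lemma time_space_decomp v :
  v = time v *: time_vec + \sum_i space v i *: space_vec i.
Proof. by rewrite {1}[v]row_sum_delta big_split_ord /= big_ord1. Qed.

(** Raising to the power [p] removes the root. The sign of [time v] is stated separately because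
    powers of negative reals are default values. *)
Lemma pcone_finP p v : 1 <= p ->
  pcone p%:E n v <-> 0 <= time v /\ \sum_i `|space v i| `^ p <= time v `^ p.
Proof.
move=> p1; have p0 : 0 < p by lra.
have sE : \sum_(i < n) `|rsubmx v 0 i| `^ p = \sum_i `|space v i| `^ p.
  by apply: eq_bigr => i _; rewrite mxE.
have S0 : 0 <= \sum_i `|space v i| `^ p.
  by apply: sumr_ge0 => i _; apply: powR_ge0.
rewrite /pcone /pnorm /= sE mxE -/(time v); split=> [h|[t0 h]].
  have t0 : 0 <= time v by apply: le_trans h; apply: powR_ge0.
  split=> //; rewrite -[leLHS]powRr1 // -(@mulVf _ p) ?gt_eqF // powRrM.
  by apply: ge0_ler_powR; rewrite ?nnegrE ?powR_ge0 // ltW.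
rewrite -[leRHS]powRr1 // -(@mulfV _ p) ?gt_eqF // powRrM.
by apply: ge0_ler_powR; rewrite ?nnegrE ?powR_ge0 // invr_ge0 ltW.
Qed.

Lemma pcone_inftyP v :
  pcone +oo%E n v <-> 0 <= time v /\ forall i, `|space v i| <= time v.
Proof.
rewrite /pcone /pnorm /= mxE -/(time v); split.
  move=> /bigmax_leP[t0 h]; split=> // i.
  by have := h i isT; rewrite mxE.
by move=> [t0 h]; apply/bigmax_leP; split=> // i _; rewrite mxE; apply: h.
Qed.

End Cone.

(** * Elementary geometry of the cone *)

Section ConeGeometry.
Context {R : realType} {n : nat}.
Implicit Types (v w y : 'rV[R]_(1 + n)) (p : R).

Lemma coord_eq0 v : time v = 0 -> (forall i, space v i = 0) -> v = 0.
Proof.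
move=> t0 x0; rewrite [v]time_space_decomp t0 scale0r add0r big1 // => i _.
by rewrite x0 scale0r.
Qed.

Lemma sum_pair (F : 'I_n -> R) i j : i != j ->
  (forall k, k != i -> k != j -> F k = 0) -> \sum_k F k = F i + F j.
Proof.
move=> ij F0; rewrite (bigD1 i) //= (bigD1 j) /=; last by rewrite eq_sym.
by rewrite big1 ?addr0 // => k /andP[ki kj]; apply: F0.
Qed.

Lemma sum_pair_le (F : 'I_n -> R) i j : i != j ->
  (forall k, 0 <= F k) -> F i + F j <= \sum_k F k.
Proof.
move=> ij F0; rewrite (bigD1 i) //= (bigD1 j) /=; last by rewrite eq_sym.
by rewrite addrA lerDl sumr_ge0.
Qed.

Lemma pcone1P v : pcone 1%:E n v <-> \sum_i `|space v i| <= time v.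
Proof.
have E : \sum_i `|space v i| `^ 1 = \sum_i `|space v i|.
  by apply: eq_bigr => i _; rewrite powRr1.
rewrite pcone_finP // E; split=> [[t0]|h]; first by rewrite powRr1.
have t0 : 0 <= time v by apply: le_trans h; apply: sumr_ge0.
by rewrite powRr1.
Qed.

Lemma pcone_space_le p v i : 1 <= p -> pcone p%:E n v -> `|space v i| <= time v.
Proof.
move=> p1 /(pcone_finP _ _ p1)[t0 h]; rewrite leNgt; apply/negP => lt.
have : time v `^ p < `|space v i| `^ p.
  by apply: gt0_ltr_powR; rewrite ?nnegrE //; lra.
apply/negP; rewrite -leNgt; apply: le_trans h.
by rewrite (bigD1 i) //= lerDl sumr_ge0 // => k _; apply: powR_ge0.
Qed.

Lemma pcone_time_gt0 p v : 1 <= p -> pcone p%:E n v -> v != 0 -> 0 < time v.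
Proof.
move=> p1 Kv; apply: contraNT; rewrite -leNgt => t0; apply/eqP/coord_eq0.
  by apply/eqP; rewrite eq_le t0; have [] := (pcone_finP _ _ p1).1 Kv.
move=> i; apply/eqP; rewrite -normr_eq0 eq_le normr_ge0 andbT.
exact: le_trans (pcone_space_le _ _ i p1 Kv) t0.
Qed.

(** Pairing such a vector with the cone will bound a linear form by a multiple of the form
    represented by [time_vec]. *)
Lemma pcone_time_vec_interior (p : \bar R) v :
  exists2 N, 0 <= N & pcone p n (N *: time_vec + v).
Proof.
exists (`|pnorm p (rsubmx v)| + `|time v|); first by rewrite addr_ge0.
rewrite /pcone /= mxE -/(time _) !coordE.
have -> : rsubmx ((`|pnorm p (rsubmx v)| + `|time v|) *: time_vec + v) =
    rsubmx v.
  apply/rowP => i; have := @space_time_vec R n i.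
  by rewrite /space !mxE => ->; rewrite mulr0 add0r.
have := ler_norm (pnorm p (rsubmx v)); have := ler_norm (- time v).
rewrite normrN; lra.
Qed.

Lemma pcone_axes p i j (a b c : R) : 1 <= p -> i != j -> 0 <= a ->
  `|b| `^ p + `|c| `^ p <= a `^ p ->
  pcone p%:E n (a *: time_vec + b *: space_vec i + c *: space_vec j).
Proof.
move=> p1 ij a0 h; have pn0 : p != 0 by rewrite gt_eqF //; lra.
apply/pcone_finP => //; rewrite !coordE !mulr0 !addr0 mulr1; split=> //.
rewrite (sum_pair _ _ _ ij) => [|k ki kj]; rewrite !coordE.
  rewrite !eqxx (negbTE ij) eq_sym (negbTE ij).
  by rewrite !mulr0 !mulr1 !addr0 !add0r.
by rewrite (negbTE ki) (negbTE kj) !mulr0 !addr0 normr0 powR0.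
Qed.

(** After division by [time v], apply Young's inequality to the pairs [(a, 1)] and [(b, t)] and add,
    using [a^p + b^p <= 1]. The bound is weaker than Hoelder's but has the same order in [t], and
    avoids a root. *)
Lemma pcone_hoelder p v i j (t : R) : 1 < p -> i != j -> pcone p%:E n v ->
  0 <= t ->
  `|space v i| + t * `|space v j| <= (1 + t `^ (p / (p - 1))) * time v.
Proof.
move=> p1 ij Kv t0; have p1' : 1 <= p by lra.
have [->|v0] := eqVneq v 0.
  by rewrite /space /time !mxE normr0 !mulr0 addr0.
have T0 := pcone_time_gt0 _ _ p1' Kv v0.
have [_ h] := (pcone_finP _ _ p1').1 Kv.
have := sum_pair_le (fun k => `|space v k| `^ p) _ _ ij (fun k => powR_ge0 _ _).
move=> /le_trans/(_ h){h}; set T := time v in T0 *.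
have E (x : R) : `|x| = T * (`|x| / T) by field; rewrite gt_eqF.
rewrite (E (space v i)) (E (space v j)).
set a := `|space v i| / T; set b := `|space v j| / T.
have a0 : 0 <= a by rewrite divr_ge0 // ltW.
have b0 : 0 <= b by rewrite divr_ge0 // ltW.
clearbody a b.
rewrite !powRM ?(ltW T0) // -mulrDr -[leRHS]mulr1 ler_pM2l ?powR_gt0 // => h.
pose q := p / (p - 1).
have q0 : 0 < q by rewrite divr_gt0 //; lra.
have pq : p^-1 + q^-1 = 1 by rewrite /q; field; apply/andP; split; lra.
have c1 := conjugate_powR a0 ler01 (lt_trans ltr01 p1) q0 pq.
have c2 := conjugate_powR b0 t0 (lt_trans ltr01 p1) q0 pq.
rewrite powR1 mulr1 mul1r in c1; rewrite -/q.
have ip0 : 0 < p^-1 by rewrite invr_gt0; lra.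
have iq0 : 0 < q^-1 by rewrite invr_gt0.
have tq := powR_ge0 t q.
have h1 : (a `^ p + b `^ p) / p <= p^-1 by rewrite ler_piMl // ltW.
have h2 : t `^ q / q <= t `^ q by rewrite ler_piMr //; lra.
have -> : T * a + t * (T * b) = (a + b * t) * T by ring.
rewrite ler_pM2r //; lra.
Qed.

End ConeGeometry.

(** * The polyhedral cases [p = 1] and [p = oo] *)

Section Polyhedral.
Context {R : realType} {n : nat} (ip : {dot 'rV[R]_(1 + n) for @idfun R}).
Context {h : 'I_(1 + n) -> 'rV[R]_(1 + n)}.
Context (hE : forall k v, ip (h k) v = v 0 k).

Let g := h (lshift n 0).
Let hs i := h (rshift 1 i).

Lemma dot_time v : ip g v = time v. Proof. exact: hE. Qed.
Lemma dot_space i v : ip (hs i) v = space v i. Proof. exact: hE. Qed.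

(** The facet normals [g + e *: hs k] lie in the cone by self-duality. The equations obtained for
    [e = 1] and [e = -1] are the hypotheses of [dot_absurd] for [g], [hs i], [hs j]. *)
Lemma pcone_infty_not_self_dual (i j : 'I_n) : i != j ->
  ~ self_dual ip (pcone +oo%E n).
Proof.
move=> ij sd0; have sd := self_dualP ip sd0; clear sd0.
have sgnK k (e : R) : `|e| = 1 -> pcone +oo%E n (g + e *: hs k).
  move=> e1; apply/sd => y /pcone_inftyP[t0 /(_ k) yk].
  rewrite !dotE dot_time dot_space.
  have : `|e * space y k| <= time y by rewrite normrM e1 mul1r.
  by rewrite ler_norml => /andP[]; lra.
(* Otherwise [f = g + e *: hs i] could be perturbed along [space_vec j] inside
   the cone, which makes [space_vec j] orthogonal to the facet
   [time y + e * space y i = 0], and hence to itself. *)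
have facet (e : R) : `|e| = 1 ->
    `|ip (g + e *: hs i) (hs j)| = ip (g + e *: hs i) g.
  move=> e1; move: (sgnK i e e1); move fE : (g + e *: hs i) => f fK.
  rewrite dotC dot_space dotC dot_time.
  have [t0 fi] := (pcone_inftyP f).1 fK.
  apply/eqP; rewrite eq_le fi /= leNgt; apply/negP => lt.
  pose delta := time f - `|space f j|.
  have d0 : 0 < delta by rewrite subr_gt0.
  have pert s : `|s| = 1 -> pcone +oo%E n (f + (s * delta) *: space_vec j).
    move=> s1; apply/pcone_inftyP; rewrite !coordE mulr0 addr0; split=> // k.
    rewrite !coordE; have [->|kj] := eqVneq k j; last by rewrite mulr0 addr0.
    rewrite mulr1; apply: (le_trans (ler_normD _ _)).
    by rewrite normrM s1 mul1r (gtr0_norm d0) /delta; lra.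
  have yK s : `|s| = 1 ->
      pcone +oo%E n (time_vec - e *: space_vec i + s *: space_vec j).
    move=> s1; apply/pcone_inftyP; rewrite !coordE !mulr0 oppr0 !addr0.
    split=> // k; rewrite !coordE add0r.
    have [->|kj] := eqVneq k j.
      by rewrite eq_sym (negbTE ij) mulr0 oppr0 add0r mulr1 s1.
    rewrite mulr0 addr0 normrN; case: (k == i); rewrite ?mulr1 ?e1 //.
    by rewrite mulr0 normr0.
  (* The points of [yK] are orthogonal to [f], so only the perturbation contributes. Varying [s]
     makes [space_vec j] orthogonal to both points, hence to their difference [2 *: space_vec j]. *)
  have key s s' : `|s| = 1 -> `|s'| = 1 ->
      0 <= s * (ip (space_vec j) time_vec - e * ip (space_vec j) (space_vec i)
        + s' * ip (space_vec j) (space_vec j)).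
    move=> s1 s1'.
    have := (sd _).1 (pert s s1) _ (yK s' s1').
    rewrite dotDl -{1}fE [ip (g + _) _]dotDl [ip (e *: _) _]dotZl.
    rewrite dot_time dot_space.
    rewrite !coordE eqxx (negbTE ij) [ip (_ *: _) _]dotZl !dotE /= => H.
    have ee : e * e = 1 by rewrite -expr2 -real_normK ?num_real // e1 expr1n.
    rewrite -(pmulr_rge0 _ d0); lra.
  have n1 : `|1 : R| = 1 by rewrite normr1.
  have n2 : `|- 1 : R| = 1 by rewrite normrN1.
  have jj : 0 < ip (space_vec j) (space_vec j).
    apply: dot_gt0; apply: (dot_neq0 ip (hs j)).
    by rewrite dot_space !coordE eqxx oner_eq0.
  have := key _ _ n1 n1; have := key _ _ n1 n2.
  have := key _ _ n2 n1; have := key _ _ n2 n2; lra.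
have n1 : `|1 : R| = 1 by rewrite normr1.
have n2 : `|- 1 : R| = 1 by rewrite normrN1.
have ji : (j == i) = false by rewrite eq_sym; apply/negbTE.
apply: (@dot_absurd _ _ ip g (hs i) (hs j)).
- apply: (dot_neq0 ip time_vec); rewrite dotC !dotE dot_time dot_space !coordE.
  by rewrite addr0 oner_eq0.
- apply: (dot_neq0 ip time_vec); rewrite dotC !dotE dot_time dot_space !coordE.
  by rewrite subr0 oner_eq0.
- apply: (dot_neq0 ip (space_vec i)); rewrite dotC !dotE !dot_space !coordE.
  by rewrite eqxx ji addr0 oner_eq0.
- apply: (dot_neq0 ip (space_vec i)); rewrite dotC !dotE !dot_space !coordE.
  by rewrite eqxx ji subr0 oner_eq0.
- by have := (sd _).1 (sgnK i _ n1) _ (sgnK i _ n2); rewrite scale1r scaleN1r.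
- by have := (sd _).1 (sgnK j _ n1) _ (sgnK j _ n2); rewrite scale1r scaleN1r.
- by have := facet _ n1; rewrite scale1r.
- by have := facet _ n2; rewrite scaleN1r.
Qed.

Lemma pcone1_not_self_dual (i j : 'I_n) : i != j ->
  ~ self_dual ip (pcone 1%:E n).
Proof.
move=> ij sd0; have sd := self_dualP ip sd0; clear sd0.
have ji : (j == i) = false by rewrite eq_sym; apply/negbTE.
have n1 : `|1 : R| = 1 by rewrite normr1.
have n2 : `|- 1 : R| = 1 by rewrite normrN1.
have sgnK k (e : R) : `|e| = 1 -> pcone 1%:E n (time_vec + e *: space_vec k).
  move=> e1; apply/pcone1P; rewrite !coordE mulr0 addr0 (bigD1 k) //= big1.
    by rewrite !coordE eqxx mulr1 add0r e1 addr0.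
  by move=> l lk; rewrite !coordE (negbTE lk) mulr0 addr0 normr0.
(* The vectors [time_vec] plus or minus [space_vec k] generate the cone, so testing against them
   suffices. *)
have genK v : (forall k, `|ip v (space_vec k)| <= ip v time_vec) ->
    pcone 1%:E n v.
  move=> hv; apply/sd => y /pcone1P yK.
  have [|t0] := leP 0 (ip v time_vec); last first.
    by have := normr_ge0 (ip v (space_vec i)); have := hv i; lra.
  move=> t0; rewrite [y]time_space_decomp dotDr dotZr dot_sumr.
  have : - (\sum_k `|space y k| * ip v time_vec) <=
      \sum_k ip v (space y k *: space_vec k).
    rewrite -sumrN; apply: ler_sum => k _; rewrite dotZr.
    have := ler_norm (- (space y k * ip v (space_vec k))).
    rewrite normrN normrM.
    have := ler_wpM2l (normr_ge0 (space y k)) (hv k); lra.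
  rewrite -mulr_suml; have := ler_wpM2r t0 yK; lra.
(* Otherwise [f = time_vec + e *: space_vec i] could be perturbed along [hs j]
   inside the cone, although it spans an extreme ray and [space (hs j) j > 0]. *)
have facet (e : R) : `|e| = 1 ->
    `|ip (time_vec + e *: space_vec i) (space_vec j)| =
    ip (time_vec + e *: space_vec i) time_vec.
  move=> e1; move: (sgnK i e e1).
  move fE : (time_vec + e *: space_vec i) => f fK.
  have fle k : `|ip f (space_vec k)| <= ip f time_vec.
    have := (sd _).1 fK _ (sgnK k _ n1); have := (sd _).1 fK _ (sgnK k _ n2).
    by rewrite !dotDr !dotZr ler_norml => ? ?; apply/andP; split; lra.
  apply/eqP; rewrite eq_le fle /= leNgt; apply/negP => lt.
  pose delta := ip f time_vec - `|ip f (space_vec j)|.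
  have d0 : 0 < delta by rewrite subr_gt0.
  have pert s : `|s| = 1 -> pcone 1%:E n (f + (s * delta) *: hs j).
    move=> s1; apply: genK => k.
    rewrite !dotDl !dotZl !dot_space !coordE mulr0 addr0.
    have [jk|jk] := eqVneq j k; last by rewrite mulr0 addr0.
    rewrite mulr1; apply: (le_trans (ler_normD _ _)).
    by rewrite normrM s1 mul1r (gtr0_norm d0) /delta jk; lra.
  have := (pcone1P _).1 (pert _ n1); have := (pcone1P _).1 (pert _ n2).
  have low s := sum_pair_le (fun k => `|space (f + (s * delta) *: hs j) k|)
    _ _ ij (fun k => normr_ge0 _).
  move=> /(le_trans (low _)) + /(le_trans (low _)).
  rewrite -fE !coordE eqxx ji !mulr0 !addr0 !add0r !mulr1 !mul1r !mulN1r.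
  have jj : 0 < space (hs j) j.
    rewrite -dot_space; apply: dot_gt0; apply: (dot_neq0 ip (space_vec j)).
    by rewrite dotC dot_space !coordE eqxx oner_eq0.
  have djj : 0 < delta * space (hs j) j by rewrite mulr_gt0.
  (* Adding the bounds for both signs cancels the time perturbation. The triangle inequality bounds
     the [i] terms below by 2, which leaves [delta * space (hs j) j <= 0]. *)
  have := ler_norm (delta * space (hs j) j).
  have := ler_norm (- (- delta * space (hs j) j)); rewrite normrN.
  have := ler_normD (e + delta * space (hs j) i) (e - delta * space (hs j) i).
  have -> : e + delta * space (hs j) i + (e - delta * space (hs j) i) = 2 * e.
    by ring.
  by rewrite normrM e1 mulr1 ger0_norm // !mulNr; lra.
have tne k (e : R) : (time_vec + e *: space_vec k : 'rV[R]_(1 + n)) != 0.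
  apply: (dot_neq0 ip g).
  by rewrite dot_time !coordE mulr0 addr0 oner_eq0.
apply: (@dot_absurd _ _ ip time_vec (space_vec i) (space_vec j)).
- by have := tne j 1; rewrite scale1r.
- by have := tne j (- 1); rewrite scaleN1r.
- apply: (dot_neq0 ip (hs i)); rewrite dot_space !coordE.
  by rewrite eqxx (negbTE ij) addr0 oner_eq0.
- apply: (dot_neq0 ip (hs i)); rewrite dot_space !coordE.
  by rewrite eqxx (negbTE ij) subr0 oner_eq0.
- by have := (sd _).1 (sgnK i _ n1) _ (sgnK i _ n2); rewrite scale1r scaleN1r.
- by have := (sd _).1 (sgnK j _ n1) _ (sgnK j _ n2); rewrite scale1r scaleN1r.
- by have := facet _ n1; rewrite scale1r.
- by have := facet _ n2; rewrite scaleN1r.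
Qed.

End Polyhedral.

(** * The curved cases: comparing orders of contact at dual boundary points *)

Section Curved.
Context {R : realType} {n : nat} (ip : {dot 'rV[R]_(1 + n) for @idfun R}).
Context {h : 'I_(1 + n) -> 'rV[R]_(1 + n)}.
Context (hE : forall k v, ip (h k) v = v 0 k).
Context {p : R} (p1 : 1 < p) {i j : 'I_n} (ij : i != j).
Context (sd : self_dual ip (pcone p%:E n)).

Let g := h (lshift n 0).
Let hs i := h (rshift 1 i).
Let p1' : 1 <= p. Proof. exact: ltW. Qed.
Let p_neq0 : p != 0. Proof. by rewrite gt_eqF // (lt_trans ltr01). Qed.
Let gE v : ip g v = time v. Proof. exact: hE. Qed.
Let hsE k v : ip (hs k) v = space v k. Proof. exact: hE. Qed.
Let K := pcone p%:E n.
Let w : 'rV[R]_(1 + n) := time_vec + space_vec i.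

Lemma face_pcone : K w.
Proof.
have := @pcone_axes R n p i j 1 1 0 p1' ij ler01.
rewrite !scale1r scale0r addr0; apply.
by rewrite normr1 normr0 !powR1 powR0 ?addr0.
Qed.

(** [time_vec] is half the sum of [w] and its mirror image [time_vec - space_vec i], which lies in
    the cone and so pairs nonnegatively with [w]. *)
Lemma face_time_gt0 : 0 < ip time_vec w.
Proof.
have K2 : K (time_vec - space_vec i).
  have := @pcone_axes R n p i j 1 (- 1) 0 p1' ij ler01.
  rewrite scale1r scaleN1r scale0r addr0; apply.
  by rewrite normrN1 normr0 !powR1 powR0 ?addr0.
have := (self_dualP _ sd _).1 K2 _ face_pcone.
have : 0 < ip w w.
  apply: dot_gt0; apply: (dot_neq0 ip g).
  by rewrite gE !coordE addr0 oner_eq0.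
rewrite !dotE; lra.
Qed.

(** The vector [g - hs i], rescaled to time 1; it is orthogonal to [w]. *)
Lemma exposing_vector : exists2 u, K u /\ time u = 1 &
  exists2 c, 0 < c & forall y, ip u y = c * (time y - space y i).
Proof.
have Ku : K (g - hs i).
  apply/(self_dualP _ sd) => y Ky; rewrite !dotE gE hsE subr_ge0.
  exact: le_trans (ler_norm _) (pcone_space_le _ _ i p1' Ky).
have T0 : 0 < time (g - hs i).
  apply: (pcone_time_gt0 _ _ p1' Ku); apply: (dot_neq0 ip time_vec).
  by rewrite dotC !dotE gE hsE !coordE subr0 oner_eq0.
exists ((time (g - hs i))^-1 *: (g - hs i)).
  split; last by rewrite timeZ mulVf // gt_eqF.
  apply/(self_dualP _ sd) => y Ky.
  rewrite dotZl mulr_ge0 ?invr_ge0 ?(ltW T0) //.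
  exact: (self_dualP _ sd _).1 Ku _ Ky.
exists (time (g - hs i))^-1; first by rewrite invr_gt0.
by move=> y; rewrite dotZl !dotE gE hsE.
Qed.

(** Near [u] the cone contains [u + l * s *: d] up to a time correction of order [(l * s)^2]; near
    [w] it contains [w - s *: space_vec j] up to one of order [s^p]. Their pairing is at most
    [c * s^p - l * s^2 / 2], negative for small [s]. *)
Lemma pcone_not_self_dual_gt2 : 2 < p -> False.
Proof.
move=> p2.
have [u [Ku tu] [c c0 uE]] := exposing_vector.
pose d := hs j.
pose Q := \sum_k space d k ^+ 2.
pose M := 1 + \sum_k `|space d k|.
have [C C0 smooth] := powR_two_smooth p M (ltW p2).
have [_ xle] := (pcone_finP _ _ p1').1 Ku; rewrite tu powR1 in xle.
pose C1 := C * Q / p.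
have Q0 : 0 <= Q by apply: sumr_ge0 => k _; apply: sqr_ge0.
have C10 : 0 <= C1 by rewrite divr_ge0 ?mulr_ge0 //; lra.
have wd : ip d w = 0.
  by rewrite hsE !coordE eq_sym (negbTE ij) addr0.
have wu : ip u w = 0 by rewrite uE !coordE eqxx /=; lra.
have curve s : 0 <= s <= 1 ->
    exists2 r, 0 <= r <= C1 * s ^+ 2 & K (u + s *: d + r *: time_vec).
  move=> /andP[s0 s1].
  (* Bernoulli: [P <= (1 + (P - 1) / p) `^ p], which gives membership in the
     cone without taking p-th roots. *)
  pose P e := \sum_k `|space u k + e * (s * space d k)| `^ p.
  pose r e := (P e - 1) / p - e * (s * time d).
  have P0 e : 0 <= P e by apply: sumr_ge0 => k _; apply: powR_ge0.
  have Kr e : K (u + (e * s) *: d + r e *: time_vec).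
    have E : time (u + (e * s) *: d + r e *: time_vec) = 1 + (P e - 1) / p.
      by rewrite !coordE tu /r; lra.
    have t0 : 0 <= 1 + (P e - 1) / p.
      have -> : 1 + (P e - 1) / p = (p - 1 + P e) / p by field; exact: p_neq0.
      by rewrite divr_ge0 //; have := P0 e; lra.
    apply/(pcone_finP _ _ p1'); rewrite E; split=> //.
    have := powR_bernoulli _ _ p1' t0.
    have -> : 1 + p * (1 + (P e - 1) / p - 1) = P e by field; exact: p_neq0.
    congr (_ <= _); apply: eq_bigr => k _.
    by rewrite !coordE mulr0 addr0 mulrA.
  (* Both [u] and [d] are orthogonal to [w], so pairing with [w] isolates [r e]. As
     [r 1 + r (- 1) = (P 1 + P (- 1) - 2) / p], smoothness then bounds [r 1]. *)
  have r0 e : 0 <= r e.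
    have := (self_dualP _ sd _).1 (Kr e) _ face_pcone.
    by rewrite !dotDl !dotZl wu wd mulr0 !add0r pmulr_lge0 ?face_time_gt0.
  have sumP : P 1 + P (- 1) <= 2 + C * Q * s ^+ 2.
    rewrite /P -big_split /=.
    have : \sum_k (2 * `|space u k| `^ p + C * (s * space d k) ^+ 2)
        <= 2 + C * Q * s ^+ 2.
      rewrite big_split /= -!mulr_sumr.
      have -> : \sum_k (s * space d k) ^+ 2 = s ^+ 2 * Q.
        by rewrite mulr_sumr; apply: eq_bigr => k _; rewrite exprMn.
      lra.
    apply: le_trans; apply: ler_sum => k _; rewrite mul1r mulN1r.
    apply: smooth.
      have := pcone_space_le _ _ k p1' Ku; rewrite tu => /le_trans; apply.
      by rewrite lerDl sumr_ge0.
    rewrite normrM (ger0_norm s0).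
    have : `|space d k| <= \sum_k `|space d k|.
      by rewrite [leRHS](bigD1 k) //= lerDl sumr_ge0.
    have := ler_piMl (normr_ge0 (space d k)) s1; rewrite /M; lra.
  exists (r 1); last by have := Kr 1; rewrite mul1r.
  rewrite r0 /=.
  have : (P 1 + P (- 1) - 2) / p <= C * Q * s ^+ 2 / p.
    by rewrite ler_pM2r ?invr_gt0; lra.
  have := r0 (- 1); rewrite /C1 /r; lra.
pose E := ip time_vec w + `|ip time_vec (space_vec j)| + ip time_vec time_vec.
have k0 := face_time_gt0.
have tt0 : 0 < ip time_vec time_vec.
  by apply: dot_gt0; apply: (dot_neq0 ip g); rewrite gE !coordE oner_eq0.
have E0 : 0 <= E by rewrite /E !addr_ge0 // ltW.
have C1E : 0 <= C1 * E by rewrite mulr_ge0.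
(* [E] bounds the pairing of [time_vec] with the test point; this [l] lets the correction consume at
   most half of the gain [l * s^2]. *)
pose l := (2 * (1 + C1 * E))^-1.
have l0 : 0 < l by rewrite invr_gt0; lra.
have l1 : l <= 1 by rewrite invf_le1; lra.
have lE : C1 * E * l <= 1 / 2 by rewrite /l ler_pdivrMr; lra.
have e0 : 0 < p - 2 by lra.
have l20 : 0 < l / 2 by lra.
have [s /andP[s0 s1]] := powR_small _ _ _ _ e0 (ltW c0) l20 ltr01.
rewrite -(ltr_pM2r (exprn_gt0 2 s0)).
have sp : s `^ p = s `^ (p - 2) * s ^+ 2.
  by rewrite -powR_mulrn ?(ltW s0) // -powRD ?subrK // (gt_eqF s0) implybT.
rewrite -(mulrA _ (s `^ _)) -sp; apply/negP; rewrite -leNgt.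
have [|r /andP[r0 r1] Kv] := curve (l * s).
  by rewrite mulr_ge0 ?(ltW l0) ?(ltW s0) // mulr_ile1 // ltW.
have sp0 := powR_ge0 s p.
have sp1 : s `^ p <= 1.
  by rewrite (le_trans (ge1r_powR _ p1')) ?s0.
have Ky : K (w - s *: space_vec j + s `^ p *: time_vec).
  have := @pcone_axes R n p i j (1 + s `^ p) 1 (- s) p1' ij.
  have -> : (1 + s `^ p) *: time_vec + 1 *: space_vec i + - s *: space_vec j =
    w - s *: space_vec j + s `^ p *: time_vec.
    rewrite /w scalerDl !scale1r scaleNr.
    by rewrite [RHS]addrAC [X in _ = X - _]addrAC.
  apply; first lra.
  rewrite normr1 powR1 normrN gtr0_norm //; apply: le1r_powR; lra.
have := (self_dualP _ sd _).1 Kv _ Ky.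
rewrite !dotDl !dotZl.
have -> : ip u (w - s *: space_vec j + s `^ p *: time_vec) = c * s `^ p.
  by rewrite uE !coordE eqxx (negbTE ij) /=; lra.
have -> : ip d (w - s *: space_vec j + s `^ p *: time_vec) = - s.
  by rewrite hsE !coordE eqxx eq_sym (negbTE ij) /=; lra.
have : ip time_vec (w - s *: space_vec j + s `^ p *: time_vec) <= E.
  rewrite 2!dotDr dotNr !dotZr /E.
  have := ler_norm (- ip time_vec (space_vec j)); rewrite normrN => H.
  have := ler_piMl (normr_ge0 (ip time_vec (space_vec j))) s1.
  have := ler_wpM2l (ltW s0) H.
  have := ler_piMl (ltW tt0) sp1; lra.
move=> /(ler_wpM2l r0) H.
have := ler_wpM2r E0 r1.
have : C1 * E * l * (l * s ^+ 2) <= 1 / 2 * (l * s ^+ 2).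
  by rewrite ler_wpM2r // mulr_ge0 ?sqr_ge0 // ltW.
move: H; lra.
Qed.

(** Hoelder and duality put [u + s *: d] and [u - s *: d] in the cone up to a time correction of
    order [s^q] with [q > 2], whereas uniform convexity at the boundary point [u] forces one of
    order [s^2]. *)
Lemma pcone_not_self_dual_lt2 : p < 2 -> False.
Proof.
move=> p2; have pb : 1 < p < 2 by rewrite p1.
have [u [Ku tu] [c c0 uE]] := exposing_vector.
pose q := p / (p - 1).
have q2 : 2 < q by rewrite /q ltr_pdivlMr; lra.
pose l := time (hs j).
(* Removing the time component of [hs j] is needed because the p-norm is not
   uniformly convex in the radial direction. *)
have [d dE] : {d | d = hs j - l *: u} by exists (hs j - l *: u).
have td : time d = 0 by rewrite dE !coordE tu -/l; lra.
pose Q := \sum_k space d k ^+ 2.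
have Q0 : 0 < Q.
  rewrite lt_neqAle sumr_ge0 => [|k _]; last exact: sqr_ge0.
  rewrite andbT eq_sym; apply/negP => /eqP/psumr_eq0P Q0.
  have : d != 0.
    apply: (dot_neq0 ip (space_vec j)).
    rewrite dotC dE !dotE hsE uE !coordE eqxx (negbTE ij) /=.
    by rewrite subr0 mulr0 mulr0 subr0 oner_eq0.
  move/eqP; apply; apply: coord_eq0 => // k; apply/eqP.
  by rewrite -sqrf_eq0; apply/eqP/Q0 => // ? _; apply: sqr_ge0.
have [N N0 KN] := pcone_time_vec_interior p%:E (- g).
have timeN y : K y -> time y <= N * ip time_vec y.
  by move=> Ky; have := (self_dualP _ sd _).1 KN _ Ky; rewrite !dotE gE; lra.
pose C2 := 2 * c * (2 / c) `^ q.
have C20 : 0 <= C2 by rewrite mulr_ge0 ?powR_ge0 // mulr_ge0 // ltW.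
pose C := C2 * N.
have C0 : 0 <= C by rewrite mulr_ge0.
(* For [t <= t0] the factor [mu] below stays between [c / 2] and [2 * c]; [C2] is the resulting
   bound for [mu * (t / mu)]^ q / t [^ q]. *)
pose t0 := (2 * (1 + `|l|))^-1.
have l0 := normr_ge0 l.
have t00 : 0 < t0 by rewrite invr_gt0; lra.
have t01 : t0 <= 1 by rewrite invf_le1; lra.
have curve e t : `|e| = 1 -> 0 < t <= t0 ->
    K (u + (e * t) *: d + (C * t `^ q) *: time_vec).
  move=> e1 /andP[tp tle]; apply/(self_dualP _ sd) => y Ky.
  rewrite dE !dotE hsE uE.
  (* The coefficient of [time y - space y i] once [d] is expanded; Hoelder is applied with parameter
     [t / mu]. *)
  pose mu := (1 - e * t * l) * c.
  have lt2 : `|e * t * l| <= 1 / 2.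
    rewrite !normrM e1 (gtr0_norm tp) (mul1r t).
    apply: (le_trans (ler_wpM2r l0 tle)).
    by rewrite /t0 mulrC ler_pdivrMr; lra.
  move: lt2; rewrite ler_norml => /andP[m1 m2].
  have mu1 : c / 2 <= mu by rewrite /mu mulrC ler_pM2r //; lra.
  have mu2 : mu <= 2 * c by rewrite /mu ler_pM2r //; lra.
  have mu0 : 0 < mu by apply: lt_le_trans mu1; lra.
  have tm0 : 0 <= t / mu by rewrite divr_ge0 // ltW.
  have hoel := pcone_hoelder _ _ _ _ _ p1 ij Ky tm0; rewrite -/q in hoel.
  have Ty : 0 <= time y by have [] := (pcone_finP _ _ p1').1 Ky.
  have hoel2 : - (mu * (t / mu) `^ q * time y) <=
      mu * (time y - space y i) + e * t * space y j.
    have := ler_wpM2l (ltW mu0) hoel.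
    have -> : mu * (`|space y i| + t / mu * `|space y j|) =
      mu * `|space y i| + t * `|space y j| by field; rewrite gt_eqF.
    have h1 := ler_wpM2l (ltW mu0) (ler_norm (space y i)).
    have : - (e * t * space y j) <= t * `|space y j|.
      apply: (le_trans (ler_norm _)).
      by rewrite normrN !normrM e1 mul1r (gtr0_norm tp).
    lra.
  have h3 : mu * (t / mu) `^ q <= C2 * t `^ q.
    rewrite /C2 -mulrA -powRM ?divr_ge0 ?(ltW c0) ?(ltW tp) //.
    apply: ler_pM; rewrite ?powR_ge0 ?(ltW mu0) //.
    apply: ge0_ler_powR; rewrite ?nnegrE //; first lra.
      by rewrite mulr_ge0 ?divr_ge0 // ltW.
    rewrite mulrC ler_pM2r // -[2 / c]invrK invf_div lef_pV2 ?posrE //; lra.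
  have h4 := ler_wpM2r Ty h3.
  have h5 := ler_wpM2l (mulr_ge0 C20 (powR_ge0 t q)) (timeN _ Ky).
  have -> : c * (time y - space y i) +
      e * t * (space y j - l * (c * (time y - space y i))) =
      mu * (time y - space y i) + e * t * space y j by rewrite /mu; ring.
  by rewrite /C; lra.
(* Otherwise [u] could be lowered in time by [eta] inside the cone, but then its pairing with [w]
   would be negative. *)
have bdry : 1 <= \sum_k `|space u k| `^ p.
  rewrite leNgt; apply/negP => lt.
  set S := \sum_k _ in lt.
  have S0 : 0 <= S by apply: sumr_ge0 => k _; apply: powR_ge0.
  pose eta := (1 - S) / p.
  have eta0 : 0 < eta by rewrite divr_gt0 //; lra.
  have eta1 : eta <= 1 by rewrite /eta ler_pdivrMr; lra.
  have : K (u - eta *: time_vec).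
    apply/(pcone_finP _ _ p1'); rewrite !coordE tu mulr1 subr_ge0; split=> //.
    have := @powR_bernoulli _ p (1 - eta) p1'; rewrite subr_ge0 => /(_ eta1).
    have -> : 1 + p * (1 - eta - 1) = S by rewrite /eta; field; exact: p_neq0.
    congr (_ <= _); apply: eq_bigr => k _.
    by rewrite !coordE mulr0 subr0.
  move=> /(self_dualP _ sd) /(_ _ face_pcone).
  rewrite !dotDl dotNl dotZl uE !coordE eqxx /=.
  have := mulr_gt0 eta0 face_time_gt0; lra.
pose M := 1 + \sum_k `|space d k|.
have M0 : 0 < M by rewrite ltr_wpDr // sumr_ge0.
have [k k0 convex] := powR_two_convex p M pb M0.
have e0 : 0 < q - 2 by lra.
have CC0 : 0 <= 2 * ((2 + C) * C) by rewrite mulr_ge0 // mulr_ge0 //; lra.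
have [s /andP[s0 s1]] := powR_small _ _ _ _ e0 CC0 (mulr_gt0 k0 Q0) t00.
rewrite -(ltr_pM2r (exprn_gt0 2 s0)).
have sp : s `^ q = s `^ (q - 2) * s ^+ 2.
  by rewrite -powR_mulrn ?(ltW s0) // -powRD ?subrK // (gt_eqF s0) implybT.
rewrite -(mulrA _ (s `^ _)) -sp; apply/negP; rewrite -leNgt.
have s01 : s <= 1 by apply: le_trans t01.
pose b := C * s `^ q.
have sq0 := powR_ge0 s q.
have b0 : 0 <= b by rewrite mulr_ge0.
have bC : b <= C.
  rewrite /b ler_piMr // (le_trans (ge1r_powR _ _)) ?s0 //; lra.
have bound e : `|e| = 1 ->
    \sum_k `|space u k + e * (s * space d k)| `^ p <= 1 + (2 + C) * b.
  move=> e1; have := curve e s e1; rewrite s0 s1 => /(_ isT).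
  move=> /(pcone_finP _ _ p1')[_]; rewrite -/b !coordE tu td mulr0 mulr1 addr0.
  under eq_bigr do rewrite !coordE mulr0 addr0 -mulrA.
  move=> /le_trans; apply.
  (* As [p < 2] and [b <= C], the power is at most [(1 + b)^2 <= 1 + (2 + C) * b]. *)
  apply: (@le_trans _ _ ((1 + b) `^ 2)); first by apply: ler_powR; lra.
  rewrite powR_mulrn; last lra.
  have := ler_wpM2r b0 bC; lra.
have := bound 1 (normr1 _); have := bound (- 1) (normrN1 _).
under eq_bigr do rewrite mulN1r.
under [X in _ -> X <= _ -> _]eq_bigr do rewrite mul1r.
have : \sum_l (2 * `|space u l| `^ p + k * (s * space d l) ^+ 2) <=
  \sum_l (`|space u l + s * space d l| `^ p +
          `|space u l - s * space d l| `^ p).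
  apply: ler_sum => m _; apply: convex.
    have := pcone_space_le _ _ m p1' Ku; rewrite tu => /le_trans; apply.
    by rewrite lerDl sumr_ge0.
  rewrite normrM (gtr0_norm s0).
  have : `|space d m| <= \sum_k `|space d k|.
    by rewrite [leRHS](bigD1 m) //= lerDl sumr_ge0.
  have := ler_piMl (normr_ge0 (space d m)) s01; rewrite /M; lra.
rewrite !big_split /= -!mulr_sumr.
have -> : \sum_l (s * space d l) ^+ 2 = s ^+ 2 * Q.
  by rewrite mulr_sumr; apply: eq_bigr => m _; rewrite exprMn.
rewrite /b; lra.
Qed.

End Curved.

Theorem corollary14 (R : realType) (p : \bar R) (n : nat)
    (p_ge1 : (1%:E <= p)%E) (p_neq2 : p <> 2%:E%E) (n_ge2 : (2 <= n)%N)
    (ip : {dot 'rV[R]_(1 + n) for @idfun R}) :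
  ~ self_dual ip (pcone p n).
Proof.
have [h hE] := dot_coord ip.
pose i := Ordinal (ltnW n_ge2); pose j := Ordinal n_ge2.
have ij : i != j by [].
case: p p_ge1 p_neq2 => [p| |] //; last first.
  by move=> _ _; exact: (pcone_infty_not_self_dual ip hE _ _ ij).
rewrite lee_fin le_eqVlt => /predU1P[<- _ sd|p1 p_neq2 sd].
  exact: (pcone1_not_self_dual ip hE _ _ ij sd).
have [p2|p2|p2] := ltgtP p 2.
- exact: (pcone_not_self_dual_lt2 ip hE p1 ij sd p2).
- exact: (pcone_not_self_dual_gt2 ip hE p1 ij sd p2).
- by apply: p_neq2; rewrite p2.
Qed.
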